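(* Let $G$ and $H$ be finite simple graphs with $\operatorname{im}(G)=t$ and $\operatorname{im}(H)=r$. Then $\operatorname{im}(G\circ H)\geq tr$.
   Context: All graphs are finite and simple. A graph $G$ has a $G'$-immersion if there is an injective map $\phi:V(G')\to V(G)$ such that for every edge $uv\in E(G')$ there is a path in $G$ joining $\phi(u)$ and $\phi(v)$, and these paths are pairwise edge-disjoint. The immersion number $\operatorname{im}(G)$ is the largest $t$ such that $G$ has a $K_t$-immersion. The lexicographic product $G\circ H$ has vertex set $V(G)\times V(H)$, with $(g,h)$ adjacent to $(g',h')$ if and only if $gg'\in E(G)$, or $g=g'$ and $hh'\in E(H)$. *)

(* Defs.v *)
From mathcomp Require Import all_boot.
From mathcomp Require Import boolp.
Set Implicit Arguments.
Unset Strict Implicit.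
Unset Printing Implicit Defensive.

Record sgraph := SGraph {
  vertex :> finType;
  adj : rel vertex;
  adj_sym : symmetric adj;
  adj_irr : irreflexive adj }.

Section Paths.
Variable G : sgraph.

Definition walk_from_to (x y : G) (p : seq G) : bool :=
  if p is z :: q then [&& z == x, path (@adj G) z q & last z q == y] else false.

(* A path is the sequence of its vertices, endpoints included and without
   repetition. It is undirected: it may be listed from either endpoint. *)
Definition path_joining (x y : G) (p : seq G) : bool :=
  uniq p && (walk_from_to x y p || walk_from_to y x p).

Definition path_edges (p : seq G) : seq {set G} :=
  [seq [set a.1; a.2] | a <- zip p (behead p)].

End Paths.

(* P assigns one path to each edge of G', an edge being the unordered pair of
   its endpoints; the values of P on other sets are irrelevant. *)
Definition has_immersion (G' G : sgraph) : Prop :=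
  exists (phi : G' -> G) (P : {set G'} -> seq G),
    [/\ injective phi,
        forall u v : G', adj u v ->
          path_joining (phi u) (phi v) (P [set u; v])
      & forall u v x y : G', adj u v -> adj x y ->
          [set u; v] != [set x; y] ->
          forall e : {set G}, e \in path_edges (P [set u; v]) ->
            e \notin path_edges (P [set x; y]) ].

Section Complete.
Variable n : nat.
Definition complete_adj : rel 'I_n := fun i j => i != j.
Lemma complete_sym : symmetric complete_adj.
Proof. by move=> i j; rewrite /complete_adj eq_sym. Qed.
Lemma complete_irr : irreflexive complete_adj.
Proof. by move=> i; rewrite /complete_adj eqxx. Qed.
Definition complete : sgraph := SGraph complete_sym complete_irr.
End Complete.

(* A K_t-immersion in G needs t <= #|G|, so the range of the maximum loses
   nothing; see immersion_numberP. *)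
Definition immersion_number (G : sgraph) : nat :=
  \max_(t < #|G|.+1 | `[< has_immersion (complete t) G >]) t.

Lemma immersion_complete0 (G : sgraph) : has_immersion (complete 0) G.
Proof.
exists (fun i : complete 0 => match notF (ltn_ord i) with end), (fun=> [::]).
by split=> [[]|[]|[]].
Qed.

Lemma immersion_numberP (G : sgraph) :
  has_immersion (complete (immersion_number G)) G /\
  forall t, has_immersion (complete t) G -> t <= immersion_number G.
Proof.
split=> [|t ht].
  rewrite /immersion_number.
  have h0 : `[< has_immersion (complete (@ord0 #|G|)) G >].
    exact/asboolP/immersion_complete0.
  rewrite (bigmax_eq_arg _ h0); case: arg_maxnP => // i hi _.
  exact/asboolP.
have le_tG : t < #|G|.+1.
  case: ht => phi [P [inj_phi _ _]].
  by rewrite ltnS -[t]card_ord (leq_card phi inj_phi).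
by apply: (@leq_bigmax_cond _ _ _ (Ordinal le_tG)); apply/asboolP.
Qed.

Section Lexicographic.
Variables G H : sgraph.
Definition lex_adj : rel (G * H)%type := fun x y =>
  adj x.1 y.1 || (x.1 == y.1) && adj x.2 y.2.
Lemma lex_sym : symmetric lex_adj.
Proof.
by move=> x y; rewrite /lex_adj eq_sym adj_sym (adj_sym x.2).
Qed.
Lemma lex_irr : irreflexive lex_adj.
Proof. by move=> x; rewrite /lex_adj !adj_irr andbF. Qed.
Definition lex_product : sgraph := SGraph lex_sym lex_irr.
End Lexicographic.

(* Main.v *)
(** Let the [g_i] and [h_a] be the branch vertices of complete immersions in
    [G] and [H]; the [(g_i, h_a)] are the branch vertices in the product.
    Inside the copy [{g_i} x H] reuse the paths of [H]. For [i <> j], let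
    [x_0, ..., x_k] be the path of [G] from [g_i] to [g_j]; the path from
    [(g_i, h_a)] to [(g_j, h_b)] visits [(x_l, h_(c_l))], where
    [c_0, c_1, c_2, ...] alternates [a, a + b, a, a + b, ...] modulo [r],
    except that [c_k = b]. Each of the pairs [(a, a + b)], [(a + b, a)],
    [(a, b)], [(a + b, b)] determines [(a, b)], so the [r ^ 2] lifts of one path
    are edge-disjoint; lifts of different paths are edge-disjoint because their
    projections to [G] are. *)
Require Import Defs.
From mathcomp Require Import all_boot.
From mathcomp Require Import ssralg zmodp.

Set Implicit Arguments.
Unset Strict Implicit.
Unset Printing Implicit Defensive.

Lemma set2_inj (T : finType) (x y z w : T) :
  [set x; y] = [set z; w] -> (x = z /\ y = w) \/ (x = w /\ y = z).
Proof.
move=> E.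
have /set2P xP : x \in [set z; w] by rewrite -E set21.
have /set2P yP : y \in [set z; w] by rewrite -E set22.
have /set2P zP : z \in [set x; y] by rewrite E set21.
have /set2P wP : w \in [set x; y] by rewrite E set22.
intuition congruence.
Qed.

(** * Edges and directions of paths *)

Section Walks.
Variable G : sgraph.
Implicit Types (x y : G) (p : seq G).

Lemma walk_from_toE x0 x y p :
  walk_from_to x y p =
  [&& p != [::], nth x0 p 0 == x, sorted (@adj G) p
    & nth x0 p (size p).-1 == y].
Proof. by case: p => [|z q] //=; rewrite nth_last. Qed.

Lemma path_edgesP x0 p (e : {set G}) :
  reflect (exists2 l, l.+1 < size p & e = [set nth x0 p l; nth x0 p l.+1])
          (e \in path_edges p).
Proof.
have szE : size (zip p (behead p)) = (size p).-1.
  by rewrite size_zip size_behead; apply/minn_idPr/leq_pred.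
have nthE l : l.+1 < size p ->
    nth (x0, x0) (zip p (behead p)) l = (nth x0 p l, nth x0 p l.+1).
  by move=> lp; rewrite nth_zip_cond szE -nth_behead ltn_predRL lp.
apply: (iffP mapP) => [[a /(nthP (x0, x0))[l]] | [l lp ->]].
  by rewrite szE ltn_predRL => lp <- ->; exists l; rewrite ?nthE.
exists (nth x0 p l, nth x0 p l.+1) => //.
by rewrite -nthE //; apply: mem_nth; rewrite szE ltn_predRL.
Qed.

(** A reversed match of the two edges would need both [l = m + 1] and [l + 1 = m]. *)
Lemma path_edges_index_inj x0 p l m :
  uniq p -> l.+1 < size p -> m.+1 < size p ->
  [set nth x0 p l; nth x0 p l.+1] = [set nth x0 p m; nth x0 p m.+1] -> l = m.
Proof.
move=> Up lp mp /set2_inj [[/eqP + _]|[/eqP + /eqP]].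
  by rewrite nth_uniq ?(ltnW lp) ?(ltnW mp) // => /eqP.
rewrite !nth_uniq ?(ltnW lp) ?(ltnW mp) // => /eqP-> /eqP E.
by have := leqnSn m.+1; rewrite E ltnn.
Qed.

(** Separates copies from lifts: an edge of a copy projects to a singleton of [G], hence to no edge
    of a path. *)
Lemma path_edges_card p (e : {set G}) :
  uniq p -> e \in path_edges p -> #|e| = 2.
Proof.
case: p => [|x0 p] // Up /(path_edgesP x0)[l lp ->].
by rewrite cards2 nth_uniq ?(ltnW lp) // neq_ltn ltnSn.
Qed.

(** The lift of a path depends on its direction; the end listed first supplies one. *)
Lemma walk_from_to_orient x y p :
  x != y -> walk_from_to x y p -> ~~ walk_from_to y x p.
Proof.
case: p => [|z q] //= xy /and3P[/eqP-> _ _].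
by rewrite (negPf xy).
Qed.

End Walks.

Lemma path_edges_map (G K : sgraph) (f : G -> K) (p : seq G) :
  path_edges (map f p) = [seq f @: e | e : {set G} <- path_edges p].
Proof.
elim: p => [|x [|y p] IH] //.
have edges_cons (K' : sgraph) (u v : K') q :
  path_edges [:: u, v & q] = [set u; v] :: path_edges (v :: q) by [].
by rewrite edges_cons /= edges_cons imsetU1 imset_set1 -IH.
Qed.

(* An immersion may be given on the edges oriented by any tournament [o]. *)
Lemma complete_immersion_oriented (T : finType) (G : sgraph) (o : rel T)
    (phi : T -> G) (Q : T -> T -> seq G) :
  injective phi ->
  (forall u v, u != v -> o u v (+) o v u) ->
  (forall u v, u != v -> o u v -> path_joining (phi u) (phi v) (Q u v)) ->
  (forall u v x y, u != v -> o u v -> x != y -> o x y ->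
     forall e : {set G}, e \in path_edges (Q u v) -> e \in path_edges (Q x y) ->
     u = x /\ v = y) ->
  has_immersion (complete #|T|) G.
Proof.
move=> inj_phi oP QP Qdisj.
(* An edge is an unordered pair, so [pick] recovers its direction. Since [o] is a tournament, each
   edge has exactly one; the default [[::]] is never reached on an edge. *)
pose P (e : {set 'I_#|T|}) :=
  if [pick uv : 'I_#|T| * 'I_#|T| |
       o (enum_val uv.1) (enum_val uv.2) && (e == [set uv.1; uv.2])]
  is Some uv then Q (enum_val uv.1) (enum_val uv.2) else [::].
have ev_neq (i j : 'I_#|T|) : i != j -> enum_val i != enum_val j.
  by apply: contra_neq => /enum_val_inj.
have PE (i j : 'I_#|T|) : i != j -> o (enum_val i) (enum_val j) ->
    P [set i; j] = Q (enum_val i) (enum_val j).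
  move=> ij oij; rewrite /P; case: pickP => [[k l] /= /andP[okl /eqP]|].
    case/set2_inj => [[-> ->] //|[Ei Ej]]; subst.
    by have := oP _ _ (ev_neq _ _ ij); rewrite oij okl.
  by move/(_ (i, j)) => /=; rewrite oij eqxx.
have wlog_o (i j : 'I_#|T|) : i != j ->
    exists k l, [/\ k != l, o (enum_val k) (enum_val l),
      [set i; j] = [set k; l] & (k, l) = (i, j) \/ (k, l) = (j, i)].
  move=> ij; have := oP _ _ (ev_neq _ _ ij).
  case oij: (o (enum_val i) (enum_val j)) => /=.
    by move=> _; exists i, j; split => //; left.
  by move=> oji; exists j, i; split; rewrite 1?eq_sym // 1?setUC //; right.
exists (phi \o enum_val), P; split.
- by move=> i j /inj_phi/enum_val_inj.
- move=> i j ij; have [k [l [kl okl -> kl_ij]]] := wlog_o i j ij.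
  rewrite PE //; have := QP _ _ (ev_neq _ _ kl) okl.
  by case: kl_ij => [[-> ->] //|[-> ->]]; rewrite /path_joining /= orbC.
- move=> i j i' j' ij ij'.
  have [k [l [kl okl -> _]]] := wlog_o i j ij.
  have [k' [l' [kl' okl' -> _]]] := wlog_o i' j' ij'.
  rewrite !PE // => neq e eQ; apply: contra neq => eQ'.
  have [] := Qdisj _ _ _ _ (ev_neq _ _ kl) okl (ev_neq _ _ kl') okl' e eQ eQ'.
  by move=> /enum_val_inj-> /enum_val_inj->.
Qed.

(** * Second coordinates along a lifted path *)

Section Route.
Variables (r n : nat).
Local Open Scope ring_scope.

(** Here [n] counts the vertices of the path, so the last position is [n - 1]; its test comes first
    and overrides the alternation. The sum is modulo [r.+1]. *)
Definition route (a b : 'I_r.+1) (l : nat) : 'I_r.+1 :=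
  if l.+1 == n then b else if odd l then a + b else a.

Lemma route_first a b : (1 < n)%N -> route a b 0 = a.
Proof. by rewrite /route; case: n => [|[]]. Qed.

Lemma route_last a b : (0 < n)%N -> route a b n.-1 = b.
Proof. by rewrite /route; case: n => // m _; rewrite eqxx. Qed.

Lemma route_step_inj a b a' b' l : (l.+1 < n)%N ->
  route a b l = route a' b' l -> route a b l.+1 = route a' b' l.+1 ->
  a = a' /\ b = b'.
Proof.
move=> ln; rewrite /route (ltn_eqF ln) /=.
(* The consecutive values are, in order, [(a + b, b)], [(a, b)], [(a + b, a)] and [(a, a + b)]. *)
case: (l.+2 == n); case: (odd l) => /= E E'.
- by split=> //; move: E; rewrite E' => /GRing.addIr.
- by [].
- by split=> //; move: E; rewrite E' => /GRing.addrI.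
- by split=> //; move: E'; rewrite E => /GRing.addrI.
Qed.

End Route.

(** * Copies and lifts of paths in the product *)

Section LexPaths.
Variables G H : sgraph.
Local Notation GH := (lex_product G H).

Definition copy_path (g : G) (p : seq H) : seq GH := [seq (g, h) | h <- p].

Lemma path_joining_copy (g : G) (x y : H) (p : seq H) :
  path_joining x y p ->
  path_joining ((g, x) : GH) (g, y) (copy_path g p).
Proof.
have walk_copy u v : walk_from_to u v p ->
    @walk_from_to GH (g, u) (g, v) (copy_path g p).
  case: p => [|z q] //= /and3P[/eqP-> pq /eqP <-].
  rewrite eqxx /= (last_map (fun h => (g, h))) eqxx andbT path_map.
  by apply: sub_path pq => h h' /= hh'; rewrite /lex_adj /= eqxx hh' orbT.
case/andP=> Up W; apply/andP; split.
  by rewrite map_inj_uniq // => h h' [].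
by case/orP: W => /walk_copy->; rewrite ?orbT.
Qed.

Lemma path_edges_copy g p (e : {set GH}) :
  uniq p -> e \in path_edges (copy_path g p) ->
  [set z.1 | z in e] = [set g] /\ [set z.2 | z in e] \in path_edges p.
Proof.
move=> Up; rewrite (path_edges_map (fun h => (g, h) : GH)) => /mapP[e' e'p ->].
rewrite -!imset_comp imset_id; split=> //.
(* An empty [e'] would project to the empty set instead of [[set g]]. *)
have [h he'] : exists h, h \in e'.
  by apply/card_gt0P; rewrite (path_edges_card Up e'p).
apply/setP => x; rewrite inE; apply/imsetP/eqP => [[//]|->].
by exists h.
Qed.

(** The second coordinate is indexed by position because [route] depends on parity. The default [g0]
    is never read, as positions stay below [size p]. *)
Definition lift_path (g0 : G) (p : seq G) (c : nat -> H) : seq GH :=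
  mkseq (fun l => (nth g0 p l, c l)) (size p).

Lemma fst_lift_path g0 p c : [seq z.1 | z <- lift_path g0 p c] = p.
Proof. by rewrite /lift_path /mkseq -map_comp; apply: mkseq_nth. Qed.

(** Any [c] works: adjacency of the first coordinates suffices in the product. *)
Lemma walk_lift_path g0 x y p c :
  walk_from_to x y p ->
  walk_from_to ((x, c 0) : GH) (y, c (size p).-1) (lift_path g0 p c).
Proof.
rewrite (walk_from_toE g0) => /and4P[p0 /eqP nx sp /eqP ny].
have szp : 0 < size p by rewrite lt0n size_eq0.
rewrite (walk_from_toE ((g0, c 0) : GH)) -size_eq0 size_mkseq size_eq0 p0.
rewrite !nth_mkseq ?ltn_predL // nx ny !eqxx andbT /=.
move: sp; rewrite -{1}(fst_lift_path g0 p c) sorted_map.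
by apply: sub_sorted => z w /= zw; rewrite /lex_adj zw.
Qed.

Lemma uniq_lift_path g0 p c : uniq p -> uniq (lift_path g0 p c).
Proof. by rewrite -{1}(fst_lift_path g0 p c) => /map_uniq. Qed.

Lemma fst_path_edges_lift g0 p c (e : {set GH}) :
  e \in path_edges (lift_path g0 p c) ->
  [set z.1 | z in e] \in path_edges p.
Proof.
rewrite -[X in _ -> _ \in path_edges X](fst_lift_path g0 p c).
by rewrite (path_edges_map (fun z : GH => z.1)); apply: map_f.
Qed.

(** Projecting to [G] shows that [e] sits at the same position in both lifts. Its ends cannot be
    swapped, since consecutive vertices of [p] differ. *)
Lemma lift_path_common_edge g0 p c c' (e : {set GH}) : uniq p ->
  e \in path_edges (lift_path g0 p c) -> e \in path_edges (lift_path g0 p c') ->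
  exists l, [/\ l.+1 < size p, c l = c' l & c l.+1 = c' l.+1].
Proof.
move=> Up /(path_edgesP ((g0, c 0) : GH))[l + E] /(path_edgesP ((g0, c 0) : GH))[m + E'].
rewrite !size_mkseq => lp mp; move: E E'.
rewrite !nth_mkseq ?(ltnW lp) ?(ltnW mp) // => -> E.
have lm : l = m.
  apply: (path_edges_index_inj (x0 := g0) Up lp mp).
  by have := congr1 (fun e : {set GH} => [set z.1 | z in e]) E;
     rewrite !imsetU1 !imset_set1.
subst m; case: (set2_inj E) => [[[El] [El']]|[[/eqP + _] _]].
  by exists l.
by rewrite nth_uniq ?(ltnW lp) // ltn_eqF.
Qed.

End LexPaths.

(** * The immersion in the product *)

Lemma lex_product_immersion (G H : sgraph) (t r : nat) :
  has_immersion (complete t) G -> has_immersion (complete r) H ->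
  has_immersion (complete (t * r)) (lex_product G H).
Proof.
case: r => [|r]; first by rewrite muln0 => _ _; apply: immersion_complete0.
case=> phi [P [phi_inj PP Pdisj]] [psi [S [psi_inj SP Sdisj]]].
case: t => [|t] in phi P phi_inj PP Pdisj *.
  by rewrite mul0n; apply: immersion_complete0.
pose g0 := phi ord0.
(* Each edge is directed the way its path happens to be listed, so that lifts start at the right
   end. *)
pose oG (i j : 'I_t.+1) := walk_from_to (phi i) (phi j) (P [set i; j]).
pose o (u v : 'I_t.+1 * 'I_r.+1) :=
  if u.1 == v.1 then u.2 < v.2 else oG u.1 v.1.
pose Q (u v : 'I_t.+1 * 'I_r.+1) : seq (lex_product G H) :=
  if u.1 == v.1 then copy_path (phi u.1) (S [set u.2; v.2])
  else let p := P [set u.1; v.1] in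
    lift_path g0 p (fun l => psi (route (size p) u.2 v.2 l)).
have Puniq i j : i != j -> uniq (P [set i; j]).
  by move=> ij; case/andP: (PP i j ij).
have Suniq a b : a != b -> uniq (S [set a; b]).
  by move=> ab; case/andP: (SP a b ab).
have phi_neq i j : i != j -> phi i != phi j by apply: contra_neq => /phi_inj.
have oG_tour i j : i != j -> oG i j (+) oG j i.
  move=> ij; have /andP[_] := PP i j ij.
  rewrite /oG (setUC [set j]).
  case/orP=> W; have := walk_from_to_orient _ W.
    by rewrite W => /(_ (phi_neq _ _ ij)) /negPf->.
  by rewrite W addbT; apply; apply: phi_neq; rewrite eq_sym.
pose T : finType := ('I_t.+1 * 'I_r.+1)%type.
have <- : #|T| = t.+1 * r.+1 by rewrite card_prod !card_ord.
pose f (u : T) : lex_product G H := (phi u.1, psi u.2).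
apply: (@complete_immersion_oriented T _ o f Q).
- by move=> [i a] [j b] [/phi_inj /= -> /psi_inj ->].
- move=> [i a] [j b]; rewrite /o xpair_eqE /= (eq_sym j).
  by case: eqVneq => [_ /=|ij _]; [rewrite neq_ltn; case: ltngtP | apply: oG_tour].
- move=> [i a] [j b]; rewrite /o /Q xpair_eqE /=.
  case: eqVneq => [-> /= ab _|ij _ W]; first exact/path_joining_copy/SP.
  set p := P _; have Up : uniq p := Puniq _ _ ij.
  (* On a single vertex the first position would also be the last, and [route] would not start at
     [a]. *)
  have szp : 1 < size p.
    move: W; rewrite /oG -/p; case: (p) => [|z [|z' q]] //=.
    by case/andP=> /eqP-> /eqP/phi_inj E; rewrite E eqxx in ij.
  rewrite /path_joining uniq_lift_path //=.
  set c := (fun l => _); have := walk_lift_path g0 c W.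
  by rewrite -/p /c route_first // route_last 1?ltnW // => ->.
move=> [i a] [j b] [i' a'] [j' b']; rewrite /o /Q !xpair_eqE /=.
case: (eqVneq i j) => [<-|ij]; case: (eqVneq i' j') => [<-|ij'] /=.
(* Two copies: the projection to [G] identifies the copy, the one to [H] the path. *)
- move=> ab lab ab' lab' e /(path_edges_copy (Suniq _ _ ab))[e1 e2].
  case/(path_edges_copy (Suniq _ _ ab')) => e1' e2'.
  have /phi_inj-> : phi i = phi i' by apply/set1_inj; rewrite -e1 -e1'.
  have : [set a; b] = [set a'; b'].
    by apply: contraTeq e2' => neq; apply: (Sdisj a b a' b').
  case/set2_inj => [[-> ->] //|[Ea Eb]]; subst.
  by have := ltn_trans lab lab'; rewrite ltnn.
(* A copy and a lift: the projection to [G] would have both one and two elements. *)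
- move=> ab _ _ _ e /(path_edges_copy (Suniq _ _ ab))[e1 _] /fst_path_edges_lift.
  by rewrite e1 => /(path_edges_card (Puniq _ _ ij')); rewrite cards1.
- move=> _ _ ab _ e /fst_path_edges_lift + /(path_edges_copy (Suniq _ _ ab))[e1 _].
  by rewrite e1 => /(path_edges_card (Puniq _ _ ij)); rewrite cards1.
(* Two lifts: they come from the same path of [G], in the same direction by the tournament property,
   so [route] decides. *)
move=> _ W _ W' e eQ eQ'.
have : [set i; j] = [set i'; j'].
  apply: contraTeq (fst_path_edges_lift eQ') => neq.
  by apply: (Pdisj i j i' j') => //; apply: fst_path_edges_lift eQ.
case/set2_inj => [[Ei Ej]|[Ei Ej]]; subst; last first.
  by have := oG_tour _ _ ij; rewrite W W'.
have [l [lp /psi_inj E /psi_inj E']] := lift_path_common_edge (Puniq _ _ ij) eQ eQ'.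
by have [-> ->] := route_step_inj lp E E'.
Qed.

Theorem theorem4 (G H : sgraph) (t r : nat) :
  immersion_number G = t -> immersion_number H = r ->
  immersion_number (lex_product G H) >= t * r.
Proof.
move=> <- <-; apply: (immersion_numberP _).2.
exact: lex_product_immersion (immersion_numberP G).1 (immersion_numberP H).1.
Qed.
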